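(* Let $d\in\mathbb{N}$ with $d\ge 1$, and let $g, f_1, f_2, \dots$ be probability densities on $\mathbb{R}^d$ (with respect to Lebesgue measure) with corresponding probability distributions $G, F_1, F_2, \dots$. For each $j\in\mathbb{N}$, assume that the pair $(F_j,G)$ is TV-regular, and let $A_j := A(f_j,g)$ be a closed set with $d_{TV}(F_j,G)=F_j(A_j)-G(A_j)$ (arbitrarily chosen among such sets). Suppose that, for some $\varepsilon>0$, (i) $d_{TV}(F_j,G)\ge\varepsilon$ for all $j\in\mathbb{N}$, and (ii) $d_w(F_j,G)\to 0$ as $j\to\infty$. Then, for any sequence $(\delta_j)_{j\in\mathbb{N}}$ of real numbers with $\delta_j>d_w(F_j,G)$ for all $j$ and $\lim_{j\to\infty}\delta_j=0$, there exist a sequence $(t_j)_{j\in\mathbb{N}}$ with $t_j\in(0,\delta_j)$ for all $j$ and a compact set $K\subset\mathbb{R}^d$ (not depending on $j$) such that $$\lim_{j\to\infty}\mathcal{H}^{d-1}\bigl(P_{t_j}(f_j,g)\cap K\bigr)=\infty,\qquad\text{where } P_{t}(f_j,g)=\{x\in\mathbb{R}^d : d_{A_j}(x)=t\}.$$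
   Context: Total variation distance: $d_{TV}(F,G):=\sup_{A\in\mathcal{B}(\mathbb{R}^d)}|F(A)-G(A)|$, where $\mathcal{B}(\mathbb{R}^d)$ is the Borel $\sigma$-algebra. For $A\subseteq\mathbb{R}^d$, $d_A(x):=\inf_{y\in A}|x-y|$ is the Euclidean distance to $A$, and $A^\delta:=\{x\in\mathbb{R}^d: d_A(x)<\delta\}$ for $\delta>0$. Lévy–Prokhorov distance: $d_w(F,G):=\inf\{\delta>0: F(A)\le G(A^\delta)+\delta \text{ and } G(A)\le F(A^\delta)+\delta \text{ for all } A\in\mathcal{B}(\mathbb{R}^d)\}$. TV-regular: a pair $(F,G)$ of probability measures on $\mathbb{R}^d$ is TV-regular if there exists a closed set $A\subseteq\mathbb{R}^d$ with $d_{TV}(F,G)=F(A)-G(A)$. When $F,G$ have densities $f,g$, $A(f,g)$ denotes one such closed set, arbitrarily chosen. Passing set: for $t>0$, $P_t(f,g):=\{x\in\mathbb{R}^d: d_{A(f,g)}(x)=t\}$. Hausdorff measure (unnormalized): for $r\ge0$, $\mathcal{H}^r(E):=\lim_{\delta\to0}\inf\{\sum_{i=1}^\infty(\operatorname{diam}U_i)^r: E\subseteq\bigcup_{i=1}^\infty U_i,\ \operatorname{diam}U_i<\delta\}$, the infimum being over countable covers; $\mathcal{H}^0$ is the counting measure. *)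

(* Defs.v *)
From HB Require Import structures.
From mathcomp Require Import all_boot all_order all_algebra.
From mathcomp Require Import all_classical all_reals all_analysis.
From mathcomp Require Import measurable_realfun lra.

Set Implicit Arguments.
Unset Strict Implicit.
Unset Printing Implicit Defensive.

Import Order.TTheory GRing.Theory Num.Theory.
Import numFieldNormedType.Exports.

Local Open Scope classical_set_scope.
Local Open Scope ring_scope.

(* R^d is 'rV[R]_d.  MathComp-Analysis gives it the sup-norm topology, which is
   the usual topology of R^d; measurable sets are the Borel sets of it. *)
HB.instance Definition _ (R : realType) (d : nat) :=
  @isMeasurable.Build (sigma_display (@open 'rV[R]_d)) 'rV[R]_d
    <<s (@open 'rV[R]_d) >> (@sigma_algebra0 _ setT _) (@sigma_algebraC _ _)
    (@sigma_algebra_bigcup _ setT _).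

Section lebesgue_rV.
Context {R : realType}.

Lemma open_measurable_rV d (U : set 'rV[R]_d) : open U -> measurable U.
Proof. by move=> oU; exact: sub_gen_smallest. Qed.

Definition cons_rV d (p : R * 'rV[R]_d) : 'rV[R]_d.+1 :=
  row_mx (p.1%:M : 'rV[R]_1) p.2.

Definition uncons_rV d (x : 'rV[R]_d.+1) : R * 'rV[R]_d :=
  (x ord0 ord0, rsubmx (x : 'rV[R]_(1 + d))).

Lemma cons_rVK d : cancel (@cons_rV d) (@uncons_rV d).
Proof.
move=> [a y]; rewrite /uncons_rV /cons_rV /= row_mxKr; congr (_, _).
have -> : (ord0 : 'I_d.+1) = lshift d (ord0 : 'I_1) by exact: val_inj.
by rewrite (row_mxEl (a%:M : 'rV_1) y) !mxE eqxx mulr1n.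
Qed.

Lemma uncons_rVK d : cancel (@uncons_rV d) (@cons_rV d).
Proof.
move=> x; rewrite /uncons_rV /cons_rV /=.
suff -> : ((x ord0 ord0)%:M : 'rV[R]_1) = lsubmx (x : 'rV[R]_(1 + d)).
  exact: (@hsubmxK _ 1 1 d x).
apply/matrixP => i j; rewrite !ord1 !mxE eqxx mulr1n.
by congr (x _ _); exact: val_inj.
Qed.

Lemma ball_cons_rV d (p q : R * 'rV[R]_d) (e : R) :
  ball p.1 e q.1 -> ball p.2 e q.2 -> ball (cons_rV p) e (cons_rV q).
Proof.
have E0 (u : R * 'rV[R]_d) k : cons_rV u ord0 (lshift d (k : 'I_1)) = u.1.
  by apply: etrans (row_mxEl _ _ _ _) _; rewrite mxE (ord1 k) eqxx.
have E1 (u : R * 'rV[R]_d) k : cons_rV u ord0 (rshift 1 k) = u.2 ord0 k.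
  by apply: etrans (row_mxEr _ _ _ _) _.
move=> pq1 [e0 pq2]; split => // i j; rewrite ord1.
by have [k ->|k ->] := @split_ordP 1 d j; [rewrite !E0|rewrite !E1].
Qed.

Lemma ball_rat (x e : R) : 0 < e -> exists q : rat, ball (ratr q : R) e x.
Proof.
move=> e0; have [q] := @rat_in_itvoo R (x - e) (x + e) ltac:(by lra).
rewrite in_itv /= => /andP[? ?]; exists q.
by rewrite /ball /= ltr_norml; apply/andP; split; lra.
Qed.

Lemma measurable_cons_rV d : measurable_fun setT (@cons_rV d).
Proof.
apply: (@measurability _ _ _ _ setT _ (@open 'rV[R]_d.+1)) => //.
move=> _ [U oU <-]; rewrite setTI.
pose e (k : nat) : R := k.+1%:R^-1.
pose I : countType := (rat * 'rV[rat]_d * nat)%type.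
pose box (i : I) : set (R * 'rV[R]_d) :=
  ball (ratr i.1.1 : R) (e i.2) `*` ball (map_mx ratr i.1.2 : 'rV[R]_d) (e i.2).
have e0 k : 0 < e k by rewrite invr_gt0.
have mbox i : measurable (box i).
  apply: measurableX; first by apply: open_measurable; apply: ball_open; exact: e0.
  by apply: open_measurable_rV; apply: ball_open; exact: e0.
have -> : @cons_rV d @^-1` U = \bigcup_n
    [set p | if @unpickle I n is Some i
             then box i p /\ box i `<=` @cons_rV d @^-1` U else False].
  apply/seteqP; split => [p Up|p [n _] /=]; last first.
    by case: unpickle => // i [ip]; exact.
  have /nbhs_ballP[r /= r0 rU] := open_nbhs_nbhs (conj oU Up : open_nbhs _ _).
  have [k kr] : exists k, e k < r / 2.
    have r20 : 0 < r / 2 by rewrite divr_gt0.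
    by have [k _ /(_ k (leqnn k))] := near_infty_natSinv_lt (PosNum r20); exists k.
  have [q qp] := ball_rat p.1 (e0 k).
  have [c cp] := @choice _ _ (fun i q => ball (ratr q : R) (e k) (p.2 0 i))
    (fun i => ball_rat (p.2 0 i) (e0 k)).
  exists (@pickle I (q, \row_i c i, k)); first by [].
  rewrite /mkset pickleK.
  have pc : ball (map_mx ratr (\row_i c i) : 'rV[R]_d) (e k) p.2.
    by split => // i j; rewrite ord1 !mxE.
  split; first by split.
  move=> y [/= y1 y2]; apply: rU; apply: (@le_ball _ _ _ (e k + e k)).
    by have := kr; lra.
  apply: ball_cons_rV.
    by apply: ball_triangle y1; exact: ball_sym.
  by apply: ball_triangle y2; exact: ball_sym.
apply: bigcupT_measurable => n; case: unpickle => [i|]; last exact: measurable0.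
have [iU|iU] := pselect (box i `<=` @cons_rV d @^-1` U).
  by rewrite (_ : mkset _ = box i)//; apply/seteqP; split => [p []|p].
by rewrite (_ : mkset _ = set0)//; apply/seteqP; split => [p []|p].
Qed.

Lemma measurable_uncons_rV d : measurable_fun setT (@uncons_rV d).
Proof.
apply: measurable_fun_pair.
  apply: (measurability _ (RGenOpens.measurableE R)).
  move=> _ [_ [a [b ->] <-]]; rewrite setTI; apply: open_measurable_rV.
  have /continuousP := @coord_continuous R 1 d.+1 ord0 ord0; apply.
  exact: interval_open.
apply: (@measurability _ _ _ _ setT _ (@open 'rV[R]_d)) => //.
move=> _ [U oU <-]; rewrite setTI; apply: open_measurable_rV.
suff /continuousP : continuous (fun x : 'rV[R]_d.+1 =>
  rsubmx (x : 'rV[R]_(1 + d)) : 'rV[R]_d) by apply.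
move=> x V /nbhs_ballP[e /= e0 eV].
apply/nbhs_ballP; exists e => //= y [_ xy]; apply: eV; split => // i j.
by rewrite !mxE; exact: xy.
Qed.

Section step.
Variables (d : nat) (m : {sigma_finite_measure set 'rV[R]_d -> \bar R}).

Definition lebesgue_step : set 'rV[R]_d.+1 -> \bar R :=
  pushforward (lebesgue_measure \x m)%E (@cons_rV d).

Let step0 : lebesgue_step set0 = 0%E.
Proof. by rewrite /lebesgue_step /pushforward preimage_set0 measure0. Qed.

Let step_ge0 A : (0 <= lebesgue_step A)%E.
Proof. by apply: integral_ge0 => x _; exact: measure_ge0. Qed.

Let step_sigma_additive : semi_sigma_additive lebesgue_step.
Proof.
move=> F mF tF mUF; rewrite /lebesgue_step /pushforward preimage_bigcup.
have mcons (A : set 'rV[R]_d.+1) : measurable A -> measurable (@cons_rV d @^-1` A).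
  by move=> mA; rewrite -[X in measurable X]setTI; exact: measurable_cons_rV.
apply: measure_semi_sigma_additive.
- by move=> n; exact: mcons.
- apply/trivIsetP => /= i j _ _ ij; rewrite -preimage_setI.
  by move/trivIsetP : tF => /(_ _ _ _ _ ij) ->//; rewrite preimage_set0.
- by rewrite -preimage_bigcup; exact: mcons.
Qed.

HB.instance Definition _ := isMeasure.Build _ _ _ lebesgue_step
  step0 step_ge0 step_sigma_additive.

Let step_sigma_finite : sigma_finite setT lebesgue_step.
Proof.
have [F [FT ndF Foo]] := (sigma_finiteP _ _).1
  (sigma_finiteT (@lebesgue_measure R)).
have [G [GT ndG Goo]] := (sigma_finiteP _ _).1 (sigma_finiteT m).
exists (fun n => @uncons_rV d @^-1` (F n `*` G n)).
  rewrite -preimage_bigcup -(preimage_setT (@uncons_rV d)); congr (_ @^-1` _).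
  apply/seteqP; split => // -[x y] _.
  have [n _ Fnx] : (\bigcup_i F i) x by rewrite -FT.
  have [k _ Gky] : (\bigcup_i G i) y by rewrite -GT.
  exists (maxn n k) => //; split.
    by move: Fnx; exact/subsetPset/ndF/leq_maxl.
  by move: Gky; exact/subsetPset/ndG/leq_maxr.
move=> n; have [mFn Fnoo] := Foo n; have [mGn Gnoo] := Goo n; split.
  rewrite -[X in measurable X]setTI; apply: measurable_uncons_rV => //.
  exact: measurableX.
rewrite /lebesgue_step /pushforward -comp_preimage.
rewrite (_ : _ \o _ = id); last by apply/funext => p /=; exact: cons_rVK.
by rewrite product_measure1E// lte_mul_pinfty// ge0_fin_numE.
Qed.

HB.instance Definition _ := Measure_isSigmaFinite.Build _ _ _ lebesgue_step
  step_sigma_finite.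

End step.

(* d-dimensional Lebesgue measure, as the d-fold product of lebesgue_measure
   transported along R * 'rV_d ~ 'rV_(d+1). *)
Fixpoint lebesgue_rV d : {sigma_finite_measure set 'rV[R]_d -> \bar R} :=
  match d with
  | 0 => dirac (0 : 'rV[R]_0)
  | d'.+1 => lebesgue_step (lebesgue_rV d')
  end.

End lebesgue_rV.

Record density (R : realType) (d : nat) := Density {
  pdf :> 'rV[R]_d -> R;
  measurable_pdf : measurable_fun setT pdf;
  pdf_ge0 : forall x, 0 <= pdf x;
  integral_pdf : (\int[lebesgue_rV d]_x (pdf x)%:E = 1)%E
}.

Section law.
Context {R : realType} {d : nat}.
Variable f : density R d.

Definition law (A : set 'rV[R]_d) : \bar R :=
  (\int[lebesgue_rV d]_(x in A) (f x)%:E)%E.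

Let law0 : law set0 = 0%E.
Proof. exact: integral_set0. Qed.

Let law_ge0 A : (0 <= law A)%E.
Proof. by apply: integral_ge0 => x _; rewrite lee_fin pdf_ge0. Qed.

Let law_sigma_additive : semi_sigma_additive law.
Proof.
move=> /= F mF tF mUF; rewrite /law; apply: cvg_toP.
  apply: ereal_nondecreasing_is_cvgn => m n mn.
  by apply: lee_sum_nneg_natr => // k _ _; exact: law_ge0.
rewrite ge0_integral_bigcup//=.
- by apply/measurable_funTS/measurableT_comp => //; exact: measurable_pdf.
- by move=> x _; rewrite lee_fin pdf_ge0.
Qed.

HB.instance Definition _ := isMeasure.Build _ _ _ law
  law0 law_ge0 law_sigma_additive.

Let lawT : law setT = 1%E.
Proof. exact: integral_pdf. Qed.

HB.instance Definition _ := Measure_isProbability.Build _ _ _ law lawT.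

End law.

Section euclidean.
Context {R : realType} {d : nat}.
Implicit Types (x : 'rV[R]_d) (A E U : set 'rV[R]_d).

(* The library norm `|x| on 'rV[R]_d is the sup norm. *)
Definition enorm x : R := Num.sqrt (\sum_(i < d) x ord0 i ^+ 2).

(* +oo when A is empty. *)
Definition edist A x : \bar R := ereal_inf [set (enorm (x - y))%:E | y in A].

Definition enlargement A (delta : R) : set 'rV[R]_d :=
  [set x | (edist A x < delta%:E)%E].

Definition passing_set A (t : R) : set 'rV[R]_d := [set x | edist A x = t%:E].

Local Open Scope ereal_scope.

(* The maximum with 0 only matters for the empty set. *)
Definition diam U : \bar R :=
  maxe 0 (ereal_sup [set (enorm (z.1 - z.2))%:E | z in U `*` U]).

(* An empty set contributes 0 to a cover also when r = 0, while a singleton then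
   contributes (diam U) `^ 0 = 1; so the case r = 0 is the counting measure. *)
Definition diam_pow (r : R) U : \bar R :=
  if U == set0 then 0 else poweR (diam U) r.

Definition hausdorff_content (r : R) E (delta : R) : \bar R :=
  ereal_inf [set \sum_(0 <= i <oo) diam_pow r (U i) |
    U in [set U : nat -> set 'rV[R]_d |
      E `<=` \bigcup_i U i /\ forall i, diam (U i) < delta%:E]].

Definition hausdorff_measure (r : R) E : \bar R :=
  lim (hausdorff_content r E delta @[delta --> 0%R^'+]).

End euclidean.

Section distances.
Context {R : realType} {d : nat}.
Implicit Types F G : probability 'rV[R]_d R.
Local Open Scope ereal_scope.

Definition total_variation_dist F G : \bar R :=
  ereal_sup [set `|F A - G A| | A in measurable].

Definition levy_prokhorov F G : \bar R :=
  ereal_inf [set delta%:E | delta in [set delta : R | (0 < delta)%R /\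
    forall A, measurable A -> F A <= G (enlargement A delta) + delta%:E /\
                              G A <= F (enlargement A delta) + delta%:E]].

Definition TV_optimal F G (A : set 'rV[R]_d) :=
  closed A /\ total_variation_dist F G = F A - G A.

Definition TV_regular F G := exists A, TV_optimal F G A.

End distances.

(* Main.v *)
Require Import Defs.
From HB Require Import structures.
From mathcomp Require Import all_boot all_order all_algebra.
From mathcomp Require Import all_classical all_reals all_analysis.
From mathcomp Require Import measurable_realfun ring lra.

(** The idea is a coarea inequality for the distance function d_A, replaced
    here by a one-sided estimate that needs only covers by small sets.

    Since F_j A_j - G A_j >= eps while F_j A_j <= G (A_j^delta_j) + delta_j, the
    collar A_j^delta_j \ A_j carries G-mass at least eps - delta_j.  By tightness
    a mass of eps / 4 of it stays in a fixed cube, and by absolute continuity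
    of G that part of the collar has Lebesgue measure at least some eta > 0
    which does not depend on j ([collar_mass], [probability_tight],
    [law_absolutely_continuous]).

    On the other hand the Lebesgue measure of the collar of width delta is at
    most C * delta * h whenever every level set {d_A = t}, 0 < t < delta, has
    (d-1)-dimensional Hausdorff measure below h on a slightly larger compact set
    ([collar_cover]).  Hence some level has measure at least
    eta / (2 * C * delta_j), which tends to infinity with j.

    The volume bound cuts the collar into dyadic shells {r <= d_A < 2 r}.  Each
    point x of a shell, with nearest point a in A, lies on a ray from a, and is
    pushed along it to the point y of the level set {d_A = r / 2}.  Because the
    ray through y stays optimal up to distance r, twice as far, the map y |-> a
    is 2-Lipschitz ([nearest_lipschitz]); so the points x whose y falls in a set
    of diameter at most D <= r fill only a tube of length about r and radius
    about D, of volume at most C * r * D^(d-1) ([tube_cover]).  Summing over a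
    cover of the level set which almost realizes its Hausdorff measure bounds
    the volume of the shell by C * r * h ([shell_cover]), and the widths of the
    dyadic shells add up to delta. *)

Set Implicit Arguments.
Unset Strict Implicit.
Unset Printing Implicit Defensive.

Import Order.TTheory GRing.Theory Num.Theory.
Import numFieldNormedType.Exports.

Local Open Scope classical_set_scope.
Local Open Scope ring_scope.

(* The unqualified name is also that of the distance of extended reals. *)
Local Notation edist := Defs.edist.

(** * Euclidean norm *)

Section euclidean_norm.
Context {R : realType} {d : nat}.
Implicit Types (u v w x y z a b : 'rV[R]_d) (c : R).

Definition dotp u v : R := \sum_(i < d) u ord0 i * v ord0 i.

Lemma dotpC u v : dotp u v = dotp v u.
Proof. by apply: eq_bigr => i _; rewrite mulrC. Qed.

Lemma dotpDl u v w : dotp (u + v) w = dotp u w + dotp v w.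
Proof. by rewrite -big_split; apply: eq_bigr => i _; rewrite !mxE mulrDl. Qed.

Lemma dotpZl c u v : dotp (c *: u) v = c * dotp u v.
Proof. by rewrite mulr_sumr; apply: eq_bigr => i _; rewrite !mxE mulrA. Qed.

Lemma dotpNl u v : dotp (- u) v = - dotp u v.
Proof. by rewrite -scaleN1r dotpZl mulN1r. Qed.

Lemma dotpDr u v w : dotp w (u + v) = dotp w u + dotp w v.
Proof. by rewrite dotpC dotpDl !(dotpC w). Qed.

Lemma dotpZr c u v : dotp u (c *: v) = c * dotp u v.
Proof. by rewrite dotpC dotpZl dotpC. Qed.

Lemma dotpNr u v : dotp u (- v) = - dotp u v.
Proof. by rewrite dotpC dotpNl dotpC. Qed.

Definition dotpE := (dotpDl, dotpDr, dotpNl, dotpNr, dotpZl, dotpZr).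

Lemma dotp_ge0 u : 0 <= dotp u u.
Proof. by apply: sumr_ge0 => i _; rewrite -expr2 sqr_ge0. Qed.

Lemma enorm_ge0 u : 0 <= enorm u.
Proof. exact: sqrtr_ge0. Qed.

Lemma enorm_sqr u : enorm u ^+ 2 = dotp u u.
Proof.
rewrite /enorm sqr_sqrtr; last by apply: sumr_ge0 => i _; rewrite sqr_ge0.
by apply: eq_bigr => i _; rewrite expr2.
Qed.

Lemma cauchy_schwarz u v : dotp u v <= enorm u * enorm v.
Proof.
have [v0|v0] := eqVneq (dotp v v) 0.
  (* v = 0, since the squares of its coordinates sum to 0 *)
  have vi0 i : v ord0 i = 0.
    have /eqP := v0; rewrite psumr_eq0 => [|k _]; last by rewrite -expr2 sqr_ge0.
    by move/allP => /(_ i (mem_index_enum _)); rewrite mulf_eq0 orbb => /eqP.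
  rewrite /dotp (eq_bigr (fun=> 0)) => [|i _]; last by rewrite vi0 mulr0.
  by rewrite sumr_const mul0rn mulr_ge0 ?enorm_ge0.
have vv : 0 < dotp v v by rewrite lt_neqAle eq_sym v0 dotp_ge0.
rewrite (le_trans (ler_norm _))// -(@ler_pXn2r _ 2)//.
- rewrite exprMn !enorm_sqr real_normK ?num_real//.
  (* dotp v v times the component of u orthogonal to v *)
  have := dotp_ge0 (dotp v v *: u - dotp u v *: v).
  rewrite !dotpE (dotpC v u) => h.
  have {}h : 0 <= dotp v v * (dotp u u * dotp v v - dotp u v ^+ 2).
    by apply: le_trans h _; rewrite le_eqVlt; apply/orP; left; apply/eqP; ring.
  by move: h; rewrite pmulr_rge0// subr_ge0.
- by rewrite nnegrE mulr_ge0 ?enorm_ge0.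
Qed.

Lemma le_enorm u c : 0 <= c -> (enorm u <= c) = (dotp u u <= c ^+ 2).
Proof.
by move=> c0; rewrite -enorm_sqr ler_pXn2r// nnegrE ?enorm_ge0.
Qed.

Lemma ge_enorm u c : 0 <= c -> (c <= enorm u) = (c ^+ 2 <= dotp u u).
Proof.
by move=> c0; rewrite -enorm_sqr ler_pXn2r// nnegrE ?enorm_ge0.
Qed.

Lemma enormD u v : enorm (u + v) <= enorm u + enorm v.
Proof.
rewrite le_enorm ?addr_ge0 ?enorm_ge0// sqrrD !enorm_sqr !dotpE (dotpC v u).
by have := cauchy_schwarz u v; lra.
Qed.

Lemma enormZ c u : enorm (c *: u) = `|c| * enorm u.
Proof.
apply/eqP; rewrite -(@eqrXn2 _ 2) ?mulr_ge0 ?enorm_ge0//.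
by rewrite exprMn !enorm_sqr !dotpE real_normK ?num_real// mulrA expr2.
Qed.

Lemma enormN u : enorm (- u) = enorm u.
Proof. by rewrite -scaleN1r enormZ normrN1 mul1r. Qed.

Lemma enormB u v : enorm (u - v) = enorm (v - u).
Proof. by rewrite -enormN opprB. Qed.

Lemma enorm0 : enorm (0 : 'rV[R]_d) = 0.
Proof. by rewrite -(scale0r 0) enormZ normr0 mul0r. Qed.

Lemma enorm_triangle z x y : enorm (x - y) <= enorm (x - z) + enorm (z - y).
Proof. by apply: le_trans (enormD _ _); rewrite addrA subrK. Qed.

Lemma coord_le_enorm u i : `|u ord0 i| <= enorm u.
Proof.
rewrite ge_enorm// real_normK ?num_real// /dotp (bigD1 i)//= expr2 lerDl.
by apply: sumr_ge0 => k _; rewrite -expr2 sqr_ge0.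
Qed.

Lemma rV_norm_le u c : 0 <= c -> (forall i, `|u ord0 i| <= c) -> `|u| <= c.
Proof.
move=> c0 h; rewrite /Num.norm/= mx_normrE; apply/bigmax_leP; split => //= -[i j] _.
by rewrite ord1.
Qed.

Lemma coord_le_norm u i : `|u ord0 i| <= `|u|.
Proof.
rewrite [leRHS]/Num.norm/= mx_normrE; apply/bigmax_geP; right => /=.
by exists (ord0, i).
Qed.

Lemma norm_le_enorm u : `|u| <= enorm u.
Proof. by apply: rV_norm_le (enorm_ge0 u) _ => i; exact: coord_le_enorm. Qed.

Lemma continuous_enorm : continuous (@enorm R d).
Proof.
move=> x; apply: (@continuous_comp _ _ _ (fun x => \sum_(i < d) x ord0 i ^+ 2)).
  apply: continuous_big => [|i _ {}x]; first exact: add_continuous.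
  apply: (@continuous_comp _ _ _ (fun x : 'rV[R]_d => x ord0 i)
    (fun t : R => t ^+ 2)).
    exact: coord_continuous.
  exact: exprn_continuous.
exact: sqrt_continuous.
Qed.

End euclidean_norm.

(** * Nearest points and rays *)

Section nearest_points.
Context {R : realType} {d : nat}.
Implicit Types (x y a b : 'rV[R]_d) (A U : set 'rV[R]_d) (s r t c : R).

Lemma edist_le A x a : A a -> (edist A x <= (enorm (x - a))%:E)%E.
Proof. by move=> Aa; apply: ereal_inf_lbound; exists a. Qed.

Lemma edist_ge A x c : (forall a, A a -> c <= enorm (x - a)) ->
  (c%:E <= edist A x)%E.
Proof.
by move=> h; apply: le_ereal_inf_tmp => _ [a Aa <-]; rewrite lee_fin h.
Qed.

Definition nearest A x a :=
  A a /\ forall b, A b -> enorm (x - a) <= enorm (x - b).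

Lemma edist_nearest A x a : nearest A x a -> edist A x = (enorm (x - a))%:E.
Proof.
by move=> [Aa h]; apply/eqP; rewrite eq_le edist_le// edist_ge.
Qed.

Lemma continuous_enormB x : continuous (fun y => enorm (x - y)).
Proof.
move=> y.
apply: (@continuous_comp _ _ _ (fun y : 'rV[R]_d => x - y) (@enorm R d)).
  by apply: (@continuousB _ _ _ (fun=> x) id) => //; exact: cst_continuous.
exact: continuous_enorm.
Qed.

(** Only the part of A in a closed ball around x matters, and it is compact. *)
Lemma exists_nearest A x : closed A -> A !=set0 -> exists a, nearest A x a.
Proof.
move=> cA [a0 Aa0]; set c := enorm (x - a0).
pose B := A `&` [set y | enorm (x - y) <= c].
have cB : compact B.
  apply: bounded_closed_compact.
    exists (`|x| + c); split; first by rewrite num_real.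
    move=> M cM y [_ /= yc]; rewrite (le_trans _ (ltW cM))//.
    rewrite -[y](subKr x) (le_trans (ler_normB _ _))// lerD2l.
    exact: le_trans (norm_le_enorm _) yc.
  apply: closedI => //.
  apply: (@closed_comp _ _ (fun y => enorm (x - y)) [set r | r <= c]).
    by move=> y _; exact: continuous_enormB.
  exact: closed_le.
have [||a] := @EVT_min_rV R d (fun y => enorm (x - y)) B _ cB.
- by exists a0; split => /=.
- by apply: continuous_subspaceT => y; exact: continuous_enormB.
rewrite inE => -[Aa ac] h; exists a; split => // b Ab.
have [bc|/ltW cb] := leP (enorm (x - b)) c; last exact: le_trans ac cb.
by apply: h; rewrite inE.
Qed.

Lemma open_enlargement A c : open (enlargement A c).
Proof.
rewrite (_ : enlargement A c = \bigcup_(a in A) [set y | enorm (a - y) < c]).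
  apply: bigcup_open => a _.
  apply: (@open_comp _ _ (fun y => enorm (a - y)) [set r | r < c]).
    by move=> y _; exact: continuous_enormB.
  exact: open_lt.
apply/seteqP; split => x /=.
  by move/ereal_inf_lt => [_ [a Aa <-]]; rewrite lte_fin enormB; exists a.
move=> [a Aa /= xa]; apply: le_lt_trans (edist_le x Aa) _.
by rewrite lte_fin enormB.
Qed.

Lemma enlargementS A c c' : c <= c' -> enlargement A c `<=` enlargement A c'.
Proof. by move=> cc x /lt_le_trans; apply; rewrite lee_fin. Qed.

Definition toward a x t := a + (t / enorm (x - a)) *: (x - a).

Lemma towardBl a x t : toward a x t - a = (t / enorm (x - a)) *: (x - a).
Proof. by rewrite /toward addrC addKr. Qed.

Lemma enorm_towardBl a x t : 0 < enorm (x - a) -> 0 <= t ->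
  enorm (toward a x t - a) = t.
Proof.
move=> s0 t0; rewrite towardBl enormZ ger0_norm ?divr_ge0 ?(ltW s0)//.
by rewrite divfK ?gt_eqF.
Qed.

Lemma enorm_towardBr a x t : 0 < enorm (x - a) -> t <= enorm (x - a) ->
  enorm (x - toward a x t) = enorm (x - a) - t.
Proof.
move=> s0 t0.
have -> : x - toward a x t = (1 - t / enorm (x - a)) *: (x - a).
  by rewrite scalerBl scale1r /toward opprD addrA.
rewrite enormZ ger0_norm; last by rewrite subr_ge0 ler_pdivrMr// mul1r.
by rewrite mulrBl mul1r divfK ?gt_eqF.
Qed.

(** By the triangle inequality, a point of A closer to the intermediate point than
    a would also be closer to x. *)
Lemma nearest_toward A a x t : 0 < enorm (x - a) -> 0 <= t <= enorm (x - a) ->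
  nearest A x a -> nearest A (toward a x t) a.
Proof.
move=> s0 /andP[t0 ts] [Aa h]; split => // b Ab.
rewrite enorm_towardBl//.
have := enorm_triangle (toward a x t) x b; have := h b Ab.
by rewrite enorm_towardBr//; lra.
Qed.

(** The inequality |y - a|^2 <= |y - b|^2 expanded around a: seen from y, the
    set A bends away from a at most quadratically. *)
Lemma nearest_dotp A y a b : nearest A y a -> A b ->
  0 <= dotp (a - b) (a - b) + 2 * dotp (y - a) (a - b).
Proof.
move=> [_ /[apply]]; rewrite ge_enorm ?enorm_ge0// enorm_sqr.
have -> : y - b = (y - a) + (a - b) by rewrite addrA subrK.
by move: (y - a) (a - b) => p q; rewrite !dotpE (dotpC q p); lra.
Qed.

(** Federer's estimate for sets of positive reach.  In general the nearest-point
    map is not even continuous; here both points at distance r / 2 lie halfway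
    on segments of length r that remain shortest.  Adding the inequalities of
    [nearest_dotp] at the two ends of these segments gives
    |a - a'|^2 <= 2 <y - y', a - a'>, and Cauchy-Schwarz concludes. *)
Lemma nearest_lipschitz A a a' x x' r :
  0 < r -> r <= enorm (x - a) -> r <= enorm (x' - a') ->
  nearest A x a -> nearest A x' a' ->
  enorm (a - a') <= 2 * enorm (toward a x (r / 2) - toward a' x' (r / 2)).
Proof.
move=> r0 rs rs' na na'.
have s0 := lt_le_trans r0 rs; have s0' := lt_le_trans r0 rs'.
have half b z : toward b z r - b = 2 *: (toward b z (r / 2) - b).
  by rewrite !towardBl scalerA; congr (_ *: _); rewrite mulrA mulrCA divff ?mulr1.
have rr : 0 <= r <= enorm (x - a) by rewrite rs ltW.
have rr' : 0 <= r <= enorm (x' - a') by rewrite rs' ltW.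
have := nearest_dotp (nearest_toward s0 rr na) na'.1.
have := nearest_dotp (nearest_toward s0' rr' na') na.1.
rewrite !half; set y := toward a x _; set y' := toward a' x' _.
move=> h' h.
have {h h'} h : dotp (a - a') (a - a') <= 2 * dotp (y - y') (a - a').
  by move: h h'; rewrite !dotpE (dotpC a' a); lra.
have := cauchy_schwarz (y - y') (a - a'); rewrite -enorm_sqr in h.
move=> cs; have {cs}h := le_trans h (ler_wpM2l (ler0n R 2) cs).
have := enorm_ge0 (a - a'); rewrite le_eqVlt => /predU1P[<-|n0].
  by rewrite mulr_ge0 ?enorm_ge0.
by move: h; rewrite mulrA expr2 ler_pM2r.
Qed.

End nearest_points.

(** * Volume of cubes and of neighbourhoods of segments *)

Section tubes.
Context {R : realType}.

Lemma closed_measurable_rV d (C : set 'rV[R]_d) : closed C -> measurable C.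
Proof.
by move/closed_openC/open_measurable_rV/measurableC; rewrite setCK.
Qed.

Definition cube d (c : 'rV[R]_d) (rho : R) : set 'rV[R]_d :=
  [set x | forall i, `|x ord0 i - c ord0 i| <= rho].

Lemma closed_cube d (c : 'rV[R]_d) rho : closed (cube c rho).
Proof.
rewrite (_ : cube c rho =
    \bigcap_i [set x | `|x ord0 i - c ord0 i| <= rho]); last first.
  by apply/seteqP; split => x /= h i; [move=> _; exact: h|exact: (h i I)].
apply: closed_bigI => i _.
apply: (@closed_comp _ _ (fun x : 'rV[R]_d => `|x ord0 i - c ord0 i|)
  [set r | r <= rho]).
  move=> x _.
  apply: (@continuous_comp _ _ _ (fun x : 'rV[R]_d => x ord0 i - c ord0 i)
    (fun t : R => `|t|)).
    apply: (@continuousB _ _ _ (fun x : 'rV[R]_d => x ord0 i) (fun=> c ord0 i)).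
      exact: coord_continuous.
    exact: cst_continuous.
  exact: norm_continuous.
exact: closed_le.
Qed.

Lemma measurable_cube d (c : 'rV[R]_d) rho : measurable (cube c rho).
Proof. by apply: closed_measurable_rV; exact: closed_cube. Qed.

Lemma lebesgue_cube d (c : 'rV[R]_d) rho : 0 <= rho ->
  lebesgue_rV d (cube c rho) = ((2 * rho) ^+ d)%:E.
Proof.
move=> rho0; elim: d c => [|d IH] c.
  by rewrite /= diracE expr0 mem_set// => -[].
have preim : @cons_rV R d @^-1` cube c rho =
    `[c ord0 ord0 - rho, c ord0 ord0 + rho]%classic `*`
    cube (uncons_rV c).2 rho.
  have E0 (u : R * 'rV[R]_d) : cons_rV u ord0 ord0 = u.1.
    have -> : (ord0 : 'I_d.+1) = lshift d (ord0 : 'I_1) by exact: val_inj.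
    by apply: etrans (row_mxEl _ _ _ _) _; rewrite mxE eqxx.
  have E1 (u : R * 'rV[R]_d) k : cons_rV u ord0 (rshift 1 k) = u.2 ord0 k.
    by apply: etrans (row_mxEr _ _ _ _) _.
  apply/seteqP; split => -[a y] /=.
    move=> h; split => /=.
      by have := h ord0; rewrite E0 in_itv/= ler_distl.
    by move=> i; have := h (rshift 1 i); rewrite E1 mxE.
  move=> [/= ha hy] j; have [k ->|k ->] := @split_ordP 1 d j.
    have -> : lshift d k = ord0 by rewrite ord1; exact: val_inj.
    by rewrite E0 ler_distl; move: ha; rewrite in_itv.
  by rewrite E1; have := hy k; rewrite mxE.
rewrite /= /lebesgue_step /pushforward preim product_measure1E//; last first.
  exact: measurable_cube.
rewrite IH [X in (X * _)%E]lebesgue_measure_itv/= lte_fin exprS EFinM; congr (_ * _)%E.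
case: ifPn => [_|]; first by rewrite -EFinB; congr EFin; ring.
by rewrite -leNgt => h; congr EFin; lra.
Qed.

(** About r / D cubes of side 30 * D centered on the segment suffice: the radius
    15 * D is the radius 14 * D of the neighbourhood plus the mesh D. *)
Lemma segment_cover d (p q : 'rV[R]_d) (r D : R) : (0 < d)%N ->
  0 < D -> D <= r -> enorm q <= r ->
  exists V, [/\ measurable V,
    (lebesgue_rV d V <= (3 * 30 ^+ d * r * D ^+ d.-1)%:E)%E &
    forall x s, 0 <= s <= 1 -> enorm (x - (p + s *: q)) <= 14 * D -> V x].
Proof.
move=> d0 D0 Dr qr; have r0 : 0 < r := lt_le_trans D0 Dr.
have rD0 : 0 <= r / D by rewrite divr_ge0 ?ltW.
pose N := (Num.trunc (r / D)).+1.
have N0 : 0 < N%:R :> R by rewrite ltr0n.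
have rDN : r / D < N%:R by exact: truncnS_gt.
have NrD : N%:R <= r / D + 1 by rewrite -natr1 lerD2r truncn_le.
pose C m := cube (p + (m%:R / N%:R) *: q) (15 * D).
exists (\big[setU/set0]_(m < N.+1) C m); split.
- by apply: bigsetU_measurable => m _; exact: measurable_cube.
- apply: (@le_trans _ _ (\sum_(m < N.+1) lebesgue_rV d (C m))%E).
    by apply: Boole_inequality => m _; exact: measurable_cube.
  under eq_bigr do rewrite lebesgue_cube ?mulr_ge0 ?(ltW D0)//.
  rewrite sumEFin lee_fin sumr_const card_ord -[leLHS]mulr_natl.
  have -> : (2 * (15 * D)) ^+ d = 30 ^+ d * (D * D ^+ d.-1).
    by rewrite -exprS prednK// -exprMn; congr (_ ^+ _); ring.
  have ND : N.+1%:R * D <= 3 * r.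
    rewrite -ler_pdivlMr// -natr1 -mulrA.
    have : 1 <= r / D by rewrite ler_pdivlMr// mul1r.
    by lra.
  have K0 : 0 <= 30 ^+ d * D ^+ d.-1 :> R by rewrite mulr_ge0 ?exprn_ge0 ?ltW.
  by have := ler_wpM2l K0 ND; lra.
move=> x s /andP[s0 s1] xs; rewrite -bigcup_mkord.
have sN0 : 0 <= s * N%:R by rewrite mulr_ge0.
exists (Num.trunc (s * N%:R)) => /=.
  rewrite truncn_lt_nat// -natr1 (@le_lt_trans _ _ N%:R) ?ltrDl//.
  by rewrite ler_piMl// ltW.
move=> i; set m := Num.trunc _.
have -> (c : 'rV[R]_d) : x ord0 i - c ord0 i = (x - c) ord0 i by rewrite !mxE.
apply: le_trans (coord_le_enorm _ i) _.
apply: le_trans (enorm_triangle (p + s *: q) _ _) _.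
rewrite (_ : 15 * D = 14 * D + D); last by ring.
apply: lerD xs _.
have -> : p + s *: q - (p + (m%:R / N%:R) *: q) = (s - m%:R / N%:R) *: q.
  by rewrite scalerBl opprD addrACA subrr add0r.
have /andP[ms sm] := truncn_itv sN0; rewrite -/m in ms sm.
have rN : r / N%:R <= D.
  by rewrite ler_pdivrMr// mulrC -ler_pdivrMr// ltW.
rewrite enormZ; apply: le_trans rN; rewrite mulrC.
apply: ler_pM => //; first exact: enorm_ge0.
rewrite ger0_norm; last by rewrite subr_ge0 ler_pdivrMr.
rewrite -(ler_pM2r N0) mulrBl divfK ?mulVf ?gt_eqF//.
by move: sm; rewrite -natr1; lra.
Qed.

End tubes.
(** * Volume of collars and Hausdorff measure of level sets *)

Section collars.
Context {R : realType} {d : nat}.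
Implicit Types (x y a : 'rV[R]_d) (A U E K V : set 'rV[R]_d) (r s t D h delta : R).
Local Notation lambda := (@lebesgue_rV R d).

(** The descent from x towards A stops at distance r / 2, half of what is
    guaranteed for x, so that [nearest_lipschitz] applies at the point reached. *)
Definition tube A r U : set 'rV[R]_d :=
  [set x | exists a, [/\ nearest A x a, r <= enorm (x - a) < 2 * r &
                         U (toward a x (r / 2))]].

Lemma enorm_le_diam U x y D : U x -> U y -> (diam U <= D%:E)%E ->
  enorm (x - y) <= D.
Proof.
move=> Ux Uy; rewrite /diam ge_max => /andP[_] UD; rewrite -lee_fin.
by apply: le_trans UD; apply: ereal_sup_ubound; exists (x, y).
Qed.

(** Fix x0 in the tube.  Any other x is a + c * (y - a), with 2 <= c <= 4, where
    y is in U; as y and a move by at most D and 2 * D, the tube stays within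
    (2 + 4 * 3) * D = 14 * D of the segment carrying c |-> a0 + c * (y0 - a0). *)
Lemma tube_cover_diam A U r D : (0 < d)%N -> 0 < D -> D <= r ->
  (diam U <= D%:E)%E ->
  exists V, [/\ measurable V,
    (lambda V <= (3 * 30 ^+ d * r * D ^+ d.-1)%:E)%E & tube A r U `<=` V].
Proof.
move=> d0 D0 Dr UD; have r0 := lt_le_trans D0 Dr.
have [[x0 [a0 [na0 /andP[rs0 _] Uy0]]]|t0] := pselect (tube A r U !=set0);
  last first.
  exists set0; split => //; last by move=> x tx; case: t0; exists x.
  by rewrite measure0 lee_fin !mulr_ge0 ?exprn_ge0 ?ltW.
have s0 := lt_le_trans r0 rs0; set y0 := toward a0 x0 (r / 2) in Uy0.
have qr : enorm (2 *: (y0 - a0)) <= r.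
  by rewrite enormZ ger0_norm// enorm_towardBl//; lra.
have [V [mV lV segV]] := segment_cover (a0 + 2 *: (y0 - a0)) d0 D0 Dr qr.
exists V; split => // x [a [na /andP[rs sr] Uy]].
have s1 := lt_le_trans r0 rs; set y := toward a x (r / 2) in Uy.
(* c is the ratio of the distances from a to x and to y *)
pose c := 2 * (enorm (x - a) / r).
apply: (segV _ (enorm (x - a) / r - 1)).
  rewrite subr_ge0 lerBlDr ler_pdivlMr// mul1r rs/= ler_pdivrMr//.
  by rewrite (_ : 1 + 1 = 2)// ltW.
have xE : x = a + c *: (y - a).
  rewrite towardBl scalerA (_ : c * _ = 1) ?scale1r; last first.
    by rewrite /c; field; rewrite !gt_eqF.
  by rewrite addrC subrK.
have -> : a0 + 2 *: (y0 - a0) + (enorm (x - a) / r - 1) *: (2 *: (y0 - a0)) =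
    a0 + c *: (y0 - a0).
  rewrite -addrA; congr (_ + _); rewrite scalerA -scalerDl; congr (_ *: _).
  by rewrite /c; ring.
have -> : x - (a0 + c *: (y0 - a0)) = (a - a0) + c *: ((y - y0) - (a - a0)).
  rewrite [in LHS]xE opprD addrACA -scalerBr; congr (_ + _ *: _).
  by rewrite !opprD !opprK addrACA.
have c0 : 0 <= c by rewrite mulr_ge0// divr_ge0 ?ltW.
have c4 : c <= 4.
  have : enorm (x - a) / r <= 2 by rewrite ler_pdivrMr// ltW.
  by rewrite /c; lra.
have yD : enorm (y - y0) <= D := enorm_le_diam Uy Uy0 UD.
have aD : enorm (a - a0) <= 2 * D.
  have := nearest_lipschitz r0 rs rs0 na na0; rewrite -/y -/y0; lra.
have wD : enorm ((y - y0) - (a - a0)) <= 3 * D.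
  by have := enormD (y - y0) (- (a - a0)); rewrite enormN; lra.
apply: le_trans (enormD _ _) _; rewrite enormZ ger0_norm//.
have : c * enorm (y - y0 - (a - a0)) <= 4 * (3 * D).
  by apply: ler_pM => //; exact: enorm_ge0.
by lra.
Qed.

(** The limit of the previous bounds as D decreases to diam U.  A singleton, of
    diameter 0, needs this limit: its tube is part of a segment, and the bound
    becomes 0 if d > 1 and C * r if d = 1, where 0^0 = 1. *)
Lemma tube_cover A U r : (0 < d)%N -> 0 < r -> (diam U < r%:E)%E ->
  exists V, [/\ measurable V,
    (lambda V <= (3 * 30 ^+ d * r)%:E * diam_pow d.-1%:R U)%E &
    tube A r U `<=` V].
Proof.
move=> d0 r0 Ur.
have [->|U0] := eqVneq U set0.
  exists set0; split => //; last by move=> x [a []].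
  by rewrite measure0 /diam_pow eqxx mule0.
have [rho rho0 rhoE] : exists2 rho : R, 0 <= rho & diam U = rho%:E.
  have : (0 <= diam U)%E by rewrite /diam le_max lexx.
  by move: Ur; case: (diam U) => // s _; rewrite lee_fin; exists s.
rewrite rhoE lte_fin in Ur.
pose D (n : nat) := rho + (r - rho) * n.+1%:R^-1.
have rr : 0 < r - rho by rewrite subr_gt0.
have Drho n : rho < D n by rewrite /D ltrDl mulr_gt0.
have Dr n : D n <= r.
  rewrite /D -lerBrDl ger_pMr// invf_le1 ?ltr0n// ler1n//.
have /choice[V HV] n : exists V, [/\ measurable V,
    (lambda V <= (3 * 30 ^+ d * r * D n ^+ d.-1)%:E)%E & tube A r U `<=` V].
  apply: tube_cover_diam => //; first exact: le_lt_trans (Drho n).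
  by rewrite rhoE lee_fin ltW.
have mV : measurable (\bigcap_n V n).
  by apply: bigcapT_measurable => n; have [] := HV n.
exists (\bigcap_n V n); split => //; last first.
  by move=> x tx n _; have [_ _] := HV n; exact.
rewrite /diam_pow (negbTE U0) rhoE/= powR_mulrn// -EFinM.
have lim : (3 * 30 ^+ d * r * D n ^+ d.-1)%:E @[n --> \oo] -->
    (3 * 30 ^+ d * r * rho ^+ d.-1)%:E.
  apply: cvg_EFin; first by near=> n.
  apply: cvgMl_tmp => //=.
  apply: (@continuous_cvg _ _ _ _ _ D (fun x : R => x ^+ d.-1) rho).
    exact: exprn_continuous.
  rewrite -[X in _ --> X]addr0 -(mulr0 (r - rho)).
  apply: cvgD; first exact: cvg_cst.
  by apply: cvgMl_tmp; exact: cvg_harmonic.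
rewrite -(cvg_lim _ lim)//; apply: lime_ge.
  by apply/cvg_ex; eexists; exact: lim.
near=> n; have [mVn lVn _] := HV n; apply: le_trans lVn.
by apply: le_measure; rewrite ?inE// => x; exact.
Unshelve. all: by end_near. Qed.

(** The content increases as the mesh decreases, so its limit is its supremum. *)
Lemma hausdorff_content_le r E delta : 0 < delta ->
  (hausdorff_content r E delta <= hausdorff_measure r E)%E.
Proof.
move=> delta0; rewrite /hausdorff_measure.
have mono : {in Interval (BRight 0) (BInfty R false) &,
    {homo hausdorff_content r E : n m / n <= m >-> (m <= n)%E}}.
  move=> s t _ _ st; apply: le_ereal_inf => _ [U [EU Us] <-]; exists U => //.
  by split => // i; apply: lt_le_trans (Us i) _; rewrite lee_fin.
rewrite (cvg_lim _ (nonincreasing_at_right_cvge _ _ mono))//.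
by apply: ereal_sup_ubound; exists delta => //=; rewrite in_itv/= delta0.
Qed.

(** The tubes over a cover of {d_A = r / 2} with mesh below r cover the shell
    {r <= d_A < 2 r}.  K must contain the 2 r-neighbourhood of K0, because points
    of K0 descend to points possibly outside K0. *)
Lemma shell_cover A K0 K r h : (0 < d)%N -> closed A -> A !=set0 -> 0 < r ->
  (forall x y, K0 x -> enorm (x - y) <= 2 * r -> K y) ->
  (hausdorff_measure d.-1%:R (passing_set A (r / 2) `&` K) < h%:E)%E ->
  exists V, [/\ measurable V, (lambda V <= (3 * 30 ^+ d * r * h)%:E)%E &
    [set x | K0 x /\ (r%:E <= edist A x < (2 * r)%:E)%E] `<=` V].
Proof.
move=> d0 cA A0 r0 K0K.
move=> /(le_lt_trans (hausdorff_content_le _ _ r0)).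
move=> /ereal_inf_lt[_ [U [PU Ur] <-] Uh].
have /choice[V HV] i := tube_cover A d0 r0 (Ur i).
have mV : measurable (\bigcup_i V i).
  by apply: bigcupT_measurable => n; have [] := HV n.
exists (\bigcup_i V i); split => //.
  apply: (@le_trans _ _ (\sum_(0 <= i <oo) lambda (V i))%E).
    by apply: measure_sigma_subadditive => // i; have [] := HV i.
  apply: (@le_trans _ _ (\sum_(0 <= i <oo)
      (3 * 30 ^+ d * r)%:E * diam_pow d.-1%:R (U i))%E).
    by apply: lee_nneseries => // i _; have [] := HV i.
  have C0 : 0 <= 3 * 30 ^+ d * r by rewrite !mulr_ge0 ?exprn_ge0 ?ltW.
  rewrite nneseriesZl; last first.
    move=> i _; rewrite /diam_pow; case: ifPn => // _; exact: poweR_ge0.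
  by rewrite [leRHS]EFinM lee_wpmul2l// ltW.
move=> x [K0x /andP[rx xr]]; have [a na] := exists_nearest x cA A0.
rewrite (edist_nearest na) !(lee_fin, lte_fin) in rx xr.
have s0 := lt_le_trans r0 rx.
have [i _ Uiy] : (\bigcup_i U i) (toward a x (r / 2)).
  have rr : 0 <= r / 2 <= enorm (x - a) by lra.
  apply: PU; split.
    by rewrite /passing_set/mkset (edist_nearest (nearest_toward s0 rr na))
      enorm_towardBl//; lra.
  by apply: K0K K0x _; rewrite enorm_towardBr//; lra.
by exists i => //; have [_ _] := HV i; apply; exists a; split => //; rewrite rx.
Qed.

(** The shells with r = delta / 2^(k+1) partition the collar {0 < d_A < delta}, and
    their volume bounds form a geometric series. *)
Lemma collar_cover A K0 K delta h : (0 < d)%N -> closed A -> A !=set0 ->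
  0 < delta -> 0 <= h ->
  (forall x y, K0 x -> enorm (x - y) <= delta -> K y) ->
  (forall t, 0 < t < delta ->
    (hausdorff_measure d.-1%:R (passing_set A t `&` K) < h%:E)%E) ->
  exists V, [/\ measurable V, (lambda V <= (3 * 30 ^+ d * delta * h)%:E)%E &
    [set x | K0 x /\ (0 < edist A x < delta%:E)%E] `<=` V].
Proof.
move=> d0 cA A0 delta0 h0 K0K Hh.
pose r k := delta / (2 ^ k.+1)%:R.
have r0 k : 0 < r k by rewrite divr_gt0// ltr0n expn_gt0.
have rS k : 2 * r k = delta / (2 ^ k)%:R.
  by rewrite /r expnS natrM; field; rewrite pnatr_eq0 expn_eq0.
have rdelta k : 2 * r k <= delta.
  by rewrite rS ler_pdivrMr ?ltr0n ?expn_gt0// ler_peMr ?ler1n ?expn_gt0// ltW.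
have /choice[V HV] k : exists V, [/\ measurable V,
    (lambda V <= (3 * 30 ^+ d * r k * h)%:E)%E &
    [set x | K0 x /\ ((r k)%:E <= edist A x < (2 * r k)%:E)%E] `<=` V].
  apply: (@shell_cover A K0 K) => //.
    by move=> x y K0x xy; apply: K0K K0x _; apply: le_trans xy _.
  by apply: Hh; have := r0 k; have := rdelta k; lra.
have mV : measurable (\bigcup_i V i).
  by apply: bigcupT_measurable => n; have [] := HV n.
exists (\bigcup_i V i); split => //.
  apply: (@le_trans _ _ (\sum_(0 <= i <oo) lambda (V i))%E).
    by apply: measure_sigma_subadditive => // i; have [] := HV i.
  apply: (@le_trans _ _ (\sum_(0 <= i <oo) (3 * 30 ^+ d * h)%:E * (r i)%:E)%E).
    apply: lee_nneseries => // i _; have [_ + _] := HV i; move/le_trans; apply.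
    by rewrite -EFinM lee_fin mulrAC.
  have C0 : 0 <= 3 * 30 ^+ d * h by rewrite !mulr_ge0 ?exprn_ge0.
  rewrite nneseriesZl; last by move=> i _; rewrite lee_fin ltW.
  rewrite [X in (_ <= X%:E)%E]mulrAC [leRHS]EFinM lee_wpmul2l//.
  exact: (epsilon_trick0 xpredT (ltW delta0)).
move=> x [K0x]; case E : (edist A x) => [e| |] /andP[]; last 2 first.
- by move=> _; rewrite ltNge leey.
- by rewrite ltNge leNye.
rewrite !lte_fin => e0 ed.
(* the shell containing x is the first one whose inner radius is at most e *)
have ex : exists k, r k <= e.
  have ed0 : 0 < e / delta by rewrite divr_gt0.
  have [k _ /(_ k (leqnn k))/= ke] := near_infty_natSinv_expn_lt (PosNum ed0).
  exists k; move: ke; rewrite ltr_pdivlMr// => /ltW; apply: le_trans.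
  rewrite /r mulrC ler_pM2r// div1r natrX lef_pV2 ?posrE ?exprn_gt0//.
  by rewrite exprS ler_peMl ?exprn_ge0// ler1n.
have [k rke kmin] := ex_minnP ex.
exists k => //; have [_ _] := HV k; apply; split => //=.
rewrite E lee_fin rke lte_fin rS.
case: k rke kmin => [|k] rke kmin; first by rewrite expn0 divr1.
by rewrite ltNge; apply/negP => /kmin; rewrite ltnn.
Qed.

End collars.

(** * Mass of collars *)

Lemma measure_le_setIC disp (T : measurableType disp) (R : realType)
    (mu : {measure set T -> \bar R}) (B S : set T) :
  measurable B -> measurable S -> (mu S <= mu (B `&` S) + mu (~` B))%E.
Proof.
move=> mB mS; have mBS : measurable (B `&` S) by exact: measurableI.
have mBC : measurable (~` B) by exact: measurableC.
apply: le_trans (@measureU2 _ _ _ mu _ _ mBS mBC).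
apply: le_measure; rewrite ?inE//; first exact: measurableU.
by move=> x Sx; have [Bx|nBx] := pselect (B x); [left|right].
Qed.

Section concentration.
Context {R : realType} {d : nat}.
Implicit Types (A K S : set 'rV[R]_d) (F G : probability 'rV[R]_d R).
Implicit Types (eps delta t : R).

Lemma levy_prokhorov_ge0 F G : (0 <= levy_prokhorov F G)%E.
Proof.
apply: le_ereal_inf_tmp => _ [delta [delta0 _] <-].
by rewrite lee_fin ltW.
Qed.

Lemma closed_edist0 A (x : 'rV[R]_d) : closed A -> edist A x = 0%E -> A x.
Proof.
move=> cA; have [->|A0] := eqVneq A set0.
  by rewrite /Defs.edist image_set0 ereal_inf0.
have [a na] := exists_nearest x cA (proj1 (set0P _) A0).
rewrite (edist_nearest na) => -[xa].
have := norm_le_enorm (x - a).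
by rewrite xa normr_le0 subr_eq0 => /eqP ->; exact: na.1.
Qed.

Lemma edist_ge0 A (x : 'rV[R]_d) : (0 <= edist A x)%E.
Proof. by apply: edist_ge => a _; exact: enorm_ge0. Qed.

Lemma probability_real G S : measurable S -> exists u : R, G S = u%:E.
Proof.
by move=> mS; exists (fine (G S)); rewrite fineK//; exact: fin_num_measure.
Qed.

(** The optimality of A gives G A <= F A - eps, and the
    Levy-Prokhorov bound for A itself gives F A <= G (A^delta) + delta. *)
Lemma collar_mass F G A eps delta : TV_optimal F G A ->
  (eps%:E <= total_variation_dist F G)%E ->
  (levy_prokhorov F G < delta%:E)%E ->
  ((eps - delta)%:E <= G (enlargement A delta `\` A))%E.
Proof.
move=> [cA ->] epsTV /ereal_inf_lt[_ [delta' [delta'0 LP] <-]].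
rewrite lte_fin => dd.
have mA := closed_measurable_rV cA.
have mAd c : measurable (enlargement A c).
  by apply: open_measurable_rV; exact: open_enlargement.
have [FA _] := LP A mA.
have {}FA : (F A <= G (enlargement A delta) + delta%:E)%E.
  apply: le_trans FA _; apply: leeD; last by rewrite lee_fin ltW.
  by apply: le_measure; rewrite ?inE//; apply: enlargementS; exact: ltW.
have AAd : A `<=` enlargement A delta.
  move=> x Ax; apply: (le_lt_trans (edist_le x Ax)).
  by rewrite subrr enorm0 lte_fin (lt_trans delta'0).
have [u uE] := probability_real F mA.
have [v vE] := probability_real G mA.
have [w wE] := probability_real G (mAd delta).
have -> : G (enlargement A delta `\` A) = (w - v)%:E.
  rewrite measureD//; last by rewrite [X in (X < _)%E]wE ltry.
  by rewrite setIidr// [X in (X - _)%E]wE [X in (_ - X)%E]vE.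
move: epsTV FA; rewrite uE vE wE.
by rewrite -!EFinB -EFinD !lee_fin; lra.
Qed.

Lemma law_absolutely_continuous (g : density R d) eps : 0 < eps ->
  exists2 eta : R, 0 < eta & forall S, measurable S ->
    (lebesgue_rV d S < eta%:E)%E -> (law g S < eps%:E)%E.
Proof.
move=> eps0.
have mg (D : set 'rV[R]_d) : measurable_fun D (fun x => (g x)%:E).
  by apply/measurable_funTS/measurableT_comp => //; exact: measurable_pdf.
have g0 x : (0 <= (g x)%:E)%E by rewrite lee_fin pdf_ge0.
have ig : (lebesgue_rV d).-integrable setT (EFin \o (g : 'rV[R]_d -> R)).
  apply/integrableP; split => //.
  under eq_integral do rewrite /= ger0_norm ?pdf_ge0//.
  by rewrite integral_pdf ltry.
have [eta [eta0 H]] := integral_normr_continuous ig eps0.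
exists eta => // S mS /(H S mS); rewrite /Rintegral.
under eq_integral do rewrite ger0_norm ?pdf_ge0//.
by rewrite -lte_fin fineK//; exact: (fin_num_measure (law g) S mS).
Qed.

Definition sup_ball n : set 'rV[R]_d := cube 0 n%:R.

Lemma probability_tight G eps : 0 < eps ->
  exists n, (G (~` sup_ball n) < eps%:E)%E.
Proof.
move=> eps0.
have mB n : measurable (sup_ball n) by exact: measurable_cube.
have ndB : {homo sup_ball : m n / (m <= n)%N >-> (m <= n)%O}.
  move=> m n mn; apply/subsetPset => x h i; apply: le_trans (h i) _.
  by rewrite ler_nat.
have BT : \bigcup_n sup_ball n = setT.
  rewrite -subTset => x _; exists (Num.trunc `|x|).+1 => // i.
  rewrite mxE subr0 (le_trans (coord_le_norm x i))// ltW//.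
  exact: truncnS_gt.
have := nondecreasing_cvg_mu (mu := G) mB _ ndB.
rewrite BT => /(_ measurableT); rewrite [X in _ --> X](probability_setT G) => GB.
have e1 : ((1 - eps)%:E < 1)%E by rewrite lte_fin; lra.
have oU := open_ereal_gt_ereal (x := (1 - eps)%:E).
have [n _ /(_ n (leqnn n))/= Bn] := GB _ (open_nbhs_nbhs (conj oU e1)).
exists n; rewrite probability_setC//; have [u uE] := probability_real G (mB n).
by move: Bn; rewrite uE -EFinB !lte_fin; lra.
Qed.

Lemma compact_sup_ball n : compact (sup_ball n).
Proof.
apply: bounded_closed_compact; last exact: closed_cube.
exists n%:R; split; first by rewrite num_real.
move=> M nM x xn; apply: le_trans (ltW nM); apply: rV_norm_le => // i.
by have := xn i; rewrite mxE subr0.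
Qed.

(** The quantitative form of the theorem: c and K depend only on g and eps, so they
    serve all pairs (F, A) at once. *)
Lemma large_passing_set (g : density R d) eps : (0 < d)%N -> 0 < eps ->
  exists c K, [/\ 0 < c, compact K & forall F A delta,
    TV_optimal F (law g) A ->
    (eps%:E <= total_variation_dist F (law g))%E ->
    (levy_prokhorov F (law g) < delta%:E)%E ->
    delta <= 1 -> delta <= eps / 2 ->
    exists t, 0 < t < delta /\
      ((c / delta)%:E <= hausdorff_measure d.-1%:R (passing_set A t `&` K))%E].
Proof.
move=> d0 eps0.
have eps40 : 0 < eps / 4 by rewrite divr_gt0.
have [n nG] := probability_tight (law g) eps40.
have [eta eta0 etaG] := law_absolutely_continuous g eps40.
pose C : R := 3 * 30 ^+ d; have C0 : 0 < C by rewrite mulr_gt0 ?exprn_gt0.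
(* with h = eta / (2 * C * delta) the collar would have volume at most eta / 2 *)
exists (eta / (2 * C)), (sup_ball n.+1); split.
- by rewrite divr_gt0// mulr_gt0.
- exact: compact_sup_ball.
move=> F A delta AFG epsTV LP delta1 deltaeps.
have delta0 : 0 < delta.
  by rewrite -lte_fin; apply: le_lt_trans LP; exact: levy_prokhorov_ge0.
have [cA TVA] := AFG.
have A0 : A !=set0.
  apply/set0P/eqP => A0; move: epsTV; rewrite TVA A0 !measure0 sube0 lee_fin.
  by rewrite leNgt eps0.
apply: contrapT => /forallNP small.
have [] := @collar_cover R d A (sup_ball n) (sup_ball n.+1) delta
  (eta / (2 * C) / delta) d0 cA A0 delta0.
- by rewrite !divr_ge0 ?ltW// mulr_gt0.
- move=> x y xn xy i; rewrite mxE subr0 -natr1.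
  have := xn i; rewrite mxE subr0 => xi.
  have := coord_le_enorm (x - y) i; rewrite !mxE distrC => yx.
  by have := ler_normD (y ord0 i - x ord0 i) (x ord0 i); rewrite subrK; lra.
- move=> t tdelta; rewrite ltNge; apply/negP => h; exact: (small t).
move=> V [mV lV SV].
have mS : measurable (sup_ball n `&` (enlargement A delta `\` A)).
  apply: measurableI; first exact: measurable_cube.
  apply: measurableD; last exact: closed_measurable_rV.
  by apply: open_measurable_rV; exact: open_enlargement.
have lS : (lebesgue_rV d (sup_ball n `&` (enlargement A delta `\` A)) < eta%:E)%E.
  apply: (@le_lt_trans _ _ (eta / 2)%:E); last by rewrite lte_fin; lra.
  apply: (@le_trans _ _ (lebesgue_rV d V)).
    apply: le_measure; rewrite ?inE// => x [xn [xd xA]]; apply: SV; split => //.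
    apply/andP; split; last exact: xd.
    rewrite lt_neqAle edist_ge0 andbT; apply/eqP => /esym.
    by move/(closed_edist0 cA).
  apply: le_trans lV _; rewrite lee_fin -/C le_eqVlt; apply/orP; left.
  by apply/eqP; field; rewrite !gt_eqF.
have := etaG _ mS lS; rewrite ltNge => /negP; apply.
have := collar_mass AFG epsTV LP.
set S := enlargement A delta `\` A => mass.
have mS' : measurable S.
  apply: measurableD; last exact: closed_measurable_rV.
  by apply: open_measurable_rV; exact: open_enlargement.
have mB : measurable (sup_ball n) by exact: measurable_cube.
have split_S := measure_le_setIC (law g) mB mS'.
have [u uE] := probability_real (law g) (measurableI _ _ mB mS').
have [v vE] := probability_real (law g) (measurableC mB).
have := le_trans mass split_S.
rewrite [X in (X + _)%E]uE [X in (_ + X)%E]vE uE -EFinD lee_fin.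
by move: nG; rewrite vE lte_fin lee_fin; lra.
Qed.

End concentration.

(** * Levels with large Hausdorff measure *)

Theorem theorem2 (R : realType) (d : nat) (hd : (1 <= d)%N)
    (g : density R d) (f : nat -> density R d)
    (hreg : forall j, TV_regular (law (f j)) (law g))
    (A : nat -> set 'rV[R]_d)
    (hA : forall j, TV_optimal (law (f j)) (law g) (A j))
    (eps : R) (heps : 0 < eps)
    (hTV : forall j,
       (eps%:E <= total_variation_dist (law (f j)) (law g))%E)
    (hw : levy_prokhorov (law (f j)) (law g) @[j --> \oo] --> 0%E)
    (delta : nat -> R)
    (hdelta : forall j,
       (levy_prokhorov (law (f j)) (law g) < (delta j)%:E)%E)
    (hdelta0 : delta j @[j --> \oo] --> 0) :
  exists (t : nat -> R) (K : set 'rV[R]_d),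
    [/\ forall j, 0 < t j < delta j,
        compact K &
        hausdorff_measure (d.-1)%:R (passing_set (A j) (t j) `&` K)
          @[j --> \oo] --> +oo%E].
Proof.
have [c [K [c0 cK large]]] := large_passing_set g hd heps.
have delta_gt0 j : 0 < delta j.
  by rewrite -lte_fin; apply: le_lt_trans (hdelta j); exact: levy_prokhorov_ge0.
have /choice[t tP] j : exists t, 0 < t < delta j /\
    (delta j <= 1 -> delta j <= eps / 2 ->
    ((c / delta j)%:E <= hausdorff_measure d.-1%:R (passing_set (A j) t `&` K))%E).
  have [[d1 deps]|small] := pselect (delta j <= 1 /\ delta j <= eps / 2).
    have [t [td tH]] := large _ _ _ (hA j) (hTV j) (hdelta j) d1 deps.
    by exists t.
  (* for the finitely many j with delta j large, any level will do *)
  exists (delta j / 2); split; first by have := delta_gt0 j; lra.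
  by move=> d1 deps; case: small.
exists t, K; split => //; first by move=> j; have [] := tP j.
apply/cvgeyPge => M; near=> j.
have [_ H] := tP j; apply: le_trans (H _ _).
- rewrite lee_fin ler_pdivlMr//.
  have M1 : 0 < `|M| + 1 by rewrite ltr_wpDl.
  have : delta j <= c / (`|M| + 1).
    by near: j; apply: (cvgr_le 0) => //; rewrite divr_gt0.
  rewrite ler_pdivlMr// mulrC; apply: le_trans; apply: ler_wpM2r; first exact: ltW.
  by rewrite (le_trans (ler_norm M))// lerDl.
- by near: j; apply: (cvgr_le 0).
- by near: j; apply: (cvgr_le 0) => //; rewrite divr_gt0.
Unshelve. all: by end_near. Qed.
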